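(* Let $n,d_1,\dots,d_n$ be positive integers and let $A_i,B_i\in\mathbb{C}^{d_i\times d_i}$ be arbitrary for $i=1,\dots,n$. Then $$\sigma\!\left(\bigotimes_{i=1}^nA_i+\bigotimes_{i=1}^nB_i\right)\prec_w\left(\bigotimes_{i=1}^n\sigma(A_i)+\bigotimes_{i=1}^n\sigma(B_i)\right)^{\downarrow}.$$ If all $A_i$ and $B_i$ are positive semidefinite, then moreover $$\lambda\!\left(\bigotimes_{i=1}^nA_i+\bigotimes_{i=1}^nB_i\right)\prec\left(\bigotimes_{i=1}^n\lambda(A_i)+\bigotimes_{i=1}^n\lambda(B_i)\right)^{\downarrow}.$$
   Context: $\sigma(X)$ is the vector of singular values of a square matrix $X$ in decreasing order, and $\lambda(X)$ is the vector of eigenvalues of a Hermitian $X$ in decreasing order (both with multiplicity). $\bigotimes$ denotes the tensor (Kronecker) product of matrices, respectively of vectors; e.g. $\bigotimes_{i=1}^n\sigma(A_i)$ is the vector with entries $\prod_{i=1}^n\sigma_{x_i}(A_i)$ indexed by $x=(x_1,\dots,x_n)\in\{1,\dots,d_1\}\times\cdots\times\{1,\dots,d_n\}$, and sums of such vectors are taken entrywise with respect to this index. The superscript $\downarrow$ denotes decreasing rearrangement. For $x,y\in\mathbb{R}^N$, weak majorization $x\prec_w y$ means $\sum_{i=1}^k x_i^\downarrow\le\sum_{i=1}^k y_i^\downarrow$ for all $k\in\{1,\dots,N\}$; majorization $x\prec y$ requires in addition equality for $k=N$. *)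

(* Defs.v *)
From HB Require Import structures.
From mathcomp Require Import all_boot all_order all_algebra.
From mathcomp Require Import spectral.
From mathcomp Require Import complex.
From mathcomp Require Import reals.
Set Implicit Arguments.
Unset Strict Implicit.
Unset Printing Implicit Defensive.
Import Order.TTheory GRing.Theory Num.Theory.
Local Open Scope ring_scope.
Local Open Scope complex_scope.
Local Open Scope sesquilinear_scope.

Definition decreasing (R : realType) (N : nat) (x : 'rV[R]_N) : 'rV[R]_N :=
  \row_(i < N) (sort >=%R [seq x 0 j | j : 'I_N])`_i.

Definition weakly_majorized (R : realType) (N : nat) (x y : 'rV[R]_N) : Prop :=
  forall k : nat, (1 <= k <= N)%N ->
    \sum_(i < N | (i < k)%N) decreasing x 0 i
    <= \sum_(i < N | (i < k)%N) decreasing y 0 i.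

Definition majorized (R : realType) (N : nat) (x y : 'rV[R]_N) : Prop :=
  weakly_majorized x y
  /\ \sum_(i < N) decreasing x 0 i = \sum_(i < N) decreasing y 0 i.

(* The N eigenvalues of X, repeated according to algebraic multiplicity. *)
Definition eigenvalues (R : realType) (N : nat) (X : 'M[R[i]]_N) : seq R[i] :=
  sval (closed_field_poly_normal (char_poly X)).

(* Meaningful for Hermitian X only: its eigenvalues are real, so that taking
   real parts merely changes their type from R[i] to R. *)
Definition lambda (R : realType) (N : nat) (X : 'M[R[i]]_N) : 'rV[R]_N :=
  decreasing (\row_(i < N) complex.Re (eigenvalues X)`_i).

Definition sigma (R : realType) (N : nat) (X : 'M[R[i]]_N) : 'rV[R]_N :=
  map_mx Num.sqrt (lambda (X ^t* *m X)).

Definition psd (R : realType) (N : nat) (X : 'M[R[i]]_N) : Prop :=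
  X \is hermsymmx /\ forall v : 'cV[R[i]]_N, 0 <= (v ^t* *m X *m v) 0 0.

Notation multi_index d := {dffun forall i, 'I_(d i)}.

(* Tensor products are indexed by all x = (x_i)_i with x_i < d i. As matrix
   indices are ordinals, x is encoded by its rank in the enumeration of the
   multi-indices; the same encoding is used for rows, columns and vectors. *)
Definition component (n : nat) (d : 'I_n -> nat)
    (k : 'I_#|{: multi_index d}|) : forall i : 'I_n, 'I_(d i) :=
  (enum_val k : multi_index d).

Definition tensor_mx (R : realType) (n : nat) (d : 'I_n -> nat)
    (A : forall i : 'I_n, 'M[R[i]]_(d i)) : 'M[R[i]]_#|{: multi_index d}| :=
  \matrix_(k, l) \prod_(i < n) A i (component k i) (component l i).

Definition tensor_rv (R : realType) (n : nat) (d : 'I_n -> nat)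
    (v : forall i : 'I_n, 'rV[R]_(d i)) : 'rV[R]_#|{: multi_index d}| :=
  \row_k \prod_(i < n) v i 0 (component k i).

(* Main.v *)
Require Import Defs.
From mathcomp Require Import all_boot all_order perm all_algebra.
From mathcomp Require Import spectral complex reals ring.
Set Implicit Arguments.
Unset Strict Implicit.
Unset Printing Implicit Defensive.
Import Order.TTheory GRing.Theory Num.Theory.
Local Open Scope ring_scope.
Local Open Scope complex_scope.
Local Open Scope sesquilinear_scope.

(** Let [p_1, ..., p_k] be orthonormal, let [u_x] and [v_x] be product
    orthonormal bases, and put [p(x) = sum_j |<p_j, u_x>|^2] and
    [q(x) = sum_j |<p_j, v_x>|^2].  For down-sets [S] and [T] of multi-indices,
    with [E] and [G] the projections on the spans of the [u_x], [x] in [S], and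
    of the [v_x], [x] in [T], one has [p(S) + q(T) <= k + rank (E G)].  The rank
    is at most [#|S :&: T|]: the transition matrix is a tensor product, each of
    whose factors is a specialisation of a generic matrix with an LU
    decomposition, and triangular factors respect down-sets.  A layer-cake
    argument turns this into Ky Fan's inequality
    [sum alpha p + sum beta q <= k t + sum (alpha + beta - t)^+], whose right
    side is the sum of the [k] largest [alpha(x) + beta(x)] for a suitable [t].
    This is the positive semidefinite case; with the singular value
    decompositions [A = sum alpha(x) u_x u'_x^H], the general case reduces to it by
    [2 Re (z conj(w)) <= |z|^2 + |w|^2]. *)

(** * Tensor products of matrices over a commutative ring *)

(** The formula of [tensor_mx] over any commutative ring: the rank bound needs polynomials and
    fractions as entries. *)
Definition tensor (F : comNzRingType) (n : nat) (d : 'I_n -> nat)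
    (A : forall i : 'I_n, 'M[F]_(d i)) : 'M[F]_#|{: multi_index d}| :=
  \matrix_(k, l) \prod_(i < n) A i (component k i) (component l i).

(** Distributivity over dependent multi-indices; the product rule [tensorM] rests on it. *)
Lemma sum_multi_index (F : comNzRingType) (n : nat) (d : 'I_n -> nat)
    (f : forall i, 'I_(d i) -> F) :
  \sum_(k < #|{: multi_index d}|) \prod_(i < n) f i (component k i)
  = \prod_(i < n) \sum_(j < d i) f i j.
Proof.
pose T_ (i : 'I_n) : finType := 'I_(d i).
pose P (i : 'I_n) := [ffun j : T_ i => f i j].
transitivity (\prod_(i < n) \sum_(j : T_ i) P i j); last first.
  by apply: eq_bigr => i _; apply: eq_bigr => j _; rewrite ffunE.
under [RHS]eq_bigr do rewrite (big_tag (fun i => P i)).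
rewrite bigA_distr_big_dep -(big_fprod _ _ P).
rewrite (reindex (fun k : 'I_#|{: multi_index d}| =>
  fprod_of_dffun (enum_val k : {dffun forall i, T_ i}))) /=; last first.
  exists (fun g => enum_rank (dffun_of_fprod g)) => k _ /=.
    by rewrite fprod_of_dffunK enum_valK.
  by rewrite enum_rankK dffun_of_fprodK.
by apply: eq_bigr => k _; apply: eq_bigr => i _; rewrite fprodE ffunE.
Qed.

Lemma component_inj (n : nat) (d : 'I_n -> nat) (k l : 'I_#|{: multi_index d}|) :
  (forall i, component k i = component l i) -> k = l.
Proof. by move=> e; apply: enum_val_inj; apply/ffunP. Qed.

Section TensorAlgebra.
Variables (F : comNzRingType) (n : nat) (d : 'I_n -> nat).
Implicit Types A B : forall i : 'I_n, 'M[F]_(d i).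

Lemma tensorM A B : tensor A *m tensor B = tensor (fun i => A i *m B i).
Proof.
apply/matrixP => k l; rewrite !mxE.
under eq_bigr do rewrite !mxE -big_split /=.
rewrite (sum_multi_index
  (fun i j => A i (component k i) j * B i j (component l i))).
by apply: eq_bigr => i _; rewrite mxE.
Qed.

Lemma tensor1 : tensor (fun i => 1%:M : 'M[F]_(d i)) = 1%:M.
Proof.
apply/matrixP => k l; rewrite !mxE; case: eqVneq => [->|kl].
  by rewrite big1 // => i _; rewrite mxE eqxx.
have /existsP[i ki] : [exists i, component k i != component l i].
  apply: contraNT kl; rewrite negb_exists => /forallP e; apply/eqP.
  by apply: component_inj => i; apply/eqP; rewrite -[_ == _]negbK.
by rewrite (bigD1 i) //= mxE (negPf ki) mul0r.
Qed.

Lemma tensor_map (G : comNzRingType) (f : {rmorphism F -> G}) A :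
  map_mx f (tensor A) = tensor (fun i => map_mx f (A i)).
Proof.
apply/matrixP => k l; rewrite !mxE rmorph_prod.
by apply: eq_bigr => i _; rewrite mxE.
Qed.

Lemma tensor_tr A : (tensor A)^T = tensor (fun i => (A i)^T).
Proof.
by apply/matrixP => k l; rewrite !mxE; apply: eq_bigr => i _; rewrite mxE.
Qed.

Lemma tensor_diag (v : forall i, 'rV[F]_(d i)) :
  tensor (fun i => diag_mx (v i))
  = diag_mx (\row_k \prod_(i < n) v i 0 (component k i)).
Proof.
apply/matrixP => k l; rewrite !mxE; case: eqVneq => [->|kl] /=.
  by apply: eq_bigr => i _; rewrite mxE eqxx.
have /existsP[i ki] : [exists i, component k i != component l i].
  apply: contraNT kl; rewrite negb_exists => /forallP e; apply/eqP.
  by apply: component_inj => i; apply/eqP; rewrite -[_ == _]negbK.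
by rewrite (bigD1 i) //= mxE (negPf ki) mul0r.
Qed.

End TensorAlgebra.

Lemma tensor_mxE (R : realType) n (d : 'I_n -> nat)
  (A : forall i : 'I_n, 'M[R[i]]_(d i)) : tensor_mx A = tensor A.
Proof. by []. Qed.

(** * Rank of a tensor product cut down to two down-sets *)

Section RankBound.

Definition indic_mx (F : nzRingType) N (S : {set 'I_N}) : 'M[F]_N :=
  diag_mx (\row_k (k \in S)%:R).

Lemma indic_mx_mulE (F : nzRingType) N (S : {set 'I_N}) M (A : 'M[F]_(N, M)) i j :
  (indic_mx F S *m A) i j = (i \in S)%:R * A i j.
Proof. by rewrite mul_diag_mx !mxE. Qed.

Lemma mul_indic_mxE (F : nzRingType) N (S : {set 'I_N}) M (A : 'M[F]_(M, N)) i j :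
  (A *m indic_mx F S) i j = A i j * (j \in S)%:R.
Proof. by rewrite mul_mx_diag !mxE. Qed.

Lemma indic_mxM (F : nzRingType) N (S T : {set 'I_N}) :
  indic_mx F S *m indic_mx F T = indic_mx F (S :&: T).
Proof.
apply/matrixP => i j; rewrite indic_mx_mulE !mxE inE.
by case: (i \in S); rewrite ?mul1r ?mul0r // mul0rn.
Qed.

Lemma rank_indic_mx (F : fieldType) N (S : {set 'I_N}) :
  (\rank (indic_mx F S) <= #|S|)%N.
Proof.
rewrite /indic_mx diag_mx_sum_delta -sum1_card [X in (_ <= X)%N]big_mkcond /=.
apply: (big_ind2 (fun (A : 'M[F]_N) k => (\rank A <= k)%N)).
- by rewrite mxrank0.
- move=> A k B l Ak Bl; exact: leq_trans (mxrank_add _ _) (leq_add Ak Bl).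
- move=> i _; rewrite mxE; case: (i \in S).
    by rewrite scale1r mxrank_delta.
  by rewrite scale0r mxrank0.
Qed.

(** Bordering: the leading block is invertible, hence so are [L] and [U], and the new corner of [U']
    is the Schur complement. *)
Lemma LU_extend (K : fieldType) (n : nat) (X : 'M[K]_(n + 1)) (L U : 'M[K]_n) :
  ulsubmx X \in unitmx -> ulsubmx X = L *m U ->
  is_trig_mx L -> is_trig_mx U^T ->
  exists L' U' : 'M[K]_(n + 1),
    [/\ X = L' *m U', is_trig_mx L' & is_trig_mx U'^T].
Proof.
move=> uX eX Lt Ut; move: uX; rewrite eX unitmx_mul => /andP[Lu Uu].
exists (block_mx L 0 (dlsubmx X *m invmx U) 1%:M).
exists (block_mx U (invmx L *m ursubmx X) 0
   (drsubmx X - dlsubmx X *m invmx U *m (invmx L *m ursubmx X))).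
split; first 1 last.
- by rewrite is_trig_block_mx // eqxx Lt /= scalar_mx_is_trig.
- by rewrite tr_block_mx is_trig_block_mx // trmx0 eqxx Ut mx11_is_trig.
rewrite mulmx_block !mul0mx !mulmx0 !addr0 mul1mx -eX.
rewrite (mulmxA L) mulmxV // mul1mx -(mulmxA (dlsubmx X)) mulVmx // mulmx1.
by rewrite addrC subrK submxK.
Qed.

(* A generic matrix has an LU decomposition: its leading principal minors are
   characteristic polynomials, hence nonzero. *)
Lemma char_poly_mx_LU (F : fieldType) (n : nat) (M : 'M[F]_n) :
  exists L U : 'M[{fraction {poly F}}]_n,
    [/\ map_mx (@tofrac {poly F}) (char_poly_mx M) = L *m U,
        is_trig_mx L & is_trig_mx U^T].
Proof.
elim: n M => [|n IHn] M.
  exists 0, 0; split; rewrite ?trmx0 ?mx0_is_trig //.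
  by apply/matrixP => -[].
move: M; rewrite -addn1 => M.
have [L [U [eLU Lt Ut]]] := IHn (ulsubmx M).
have eX : ulsubmx (map_mx (@tofrac {poly F}) (char_poly_mx M))
    = map_mx (@tofrac {poly F}) (char_poly_mx (ulsubmx M)).
  by apply/matrixP => i j; rewrite !mxE -!(inj_eq val_inj).
have uX : map_mx (@tofrac {poly F}) (char_poly_mx (ulsubmx M)) \in unitmx.
  rewrite unitmxE unitfE det_map_mx tofrac_eq0 monic_neq0 //.
  exact: char_poly_monic.
by rewrite -eX in uX eLU; apply: (LU_extend uX eLU Lt Ut).
Qed.

Lemma char_poly_mx_eval0 (F : fieldType) (n : nat) (M : 'M[F]_n) :
  map_mx (horner_eval 0) (char_poly_mx M) = - M.
Proof.
apply/matrixP => i j; rewrite !mxE /horner_eval !hornerE.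
by case: (i == j); rewrite ?mulr1n ?mulr0n !hornerE.
Qed.

(* A nonzero minor at 0 is a nonzero polynomial minor. *)
Lemma rank_eval0 (F : fieldType) m n (A : 'M[{poly F}]_(m, n)) :
  (\rank (map_mx (horner_eval (0 : F)) A)
   <= \rank (map_mx (@tofrac {poly F}) A))%N.
Proof.
set A0 := map_mx _ A; set A1 := map_mx _ A.
pose f := maxrankfun A0.
have fullf : row_full (rowsub f A0)^T.
  by rewrite /row_full mxrank_tr (eqnP (maxrowsub_free A0)).
(* The selected rows and columns depend on [A0] alone, so [minor] commutes with evaluation at 0 and
   with passage to fractions. *)
pose minor K (X : 'M[K]_(m, n)) := rowsub (fullrankfun fullf) (rowsub f X)^T.
have minor_map K L (h : {rmorphism K -> L}) (X : 'M[K]_(m, n)) :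
    map_mx h (minor K X) = minor L (map_mx h X).
  by apply/matrixP => i j; rewrite !mxE.
have: \rank (minor _ A1) = \rank A0.
  apply/mxrank_unit; rewrite -minor_map unitmxE unitfE det_map_mx tofrac_eq0.
  apply: contraTneq (fullrowsub_unit fullf) => detA.
  have -> : rowsub (fullrankfun fullf) (rowsub f A0)^T = minor _ A0 by [].
  by rewrite -minor_map unitmxE unitfE det_map_mx detA rmorph0 eqxx.
move=> <-; rewrite /minor rowsubE (leq_trans (mxrankM_maxr _ _)) // mxrank_tr.
by rewrite rowsubE mxrankM_maxr.
Qed.

Lemma indic_mx_map (F G : nzRingType) (f : {rmorphism F -> G}) N (S : {set 'I_N}) :
  map_mx f (indic_mx F S) = indic_mx G S.
Proof.
by apply/matrixP => i j; rewrite !mxE rmorphMn /= rmorph_nat.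
Qed.

(** Down-sets of the componentwise order: the shape of superlevel sets of tensor products of
    decreasing nonnegative vectors. *)
Definition down_set n (d : 'I_n -> nat) (S : {set 'I_#|{: multi_index d}|}) :=
  forall k l, (forall i, (component l i <= component k i)%N) ->
    k \in S -> l \in S.

(** The entry [(k, l)] of a tensor product of lower triangular matrices vanishes unless [l <= k]
    componentwise, so a row indexed in a down-set is supported there. *)
Lemma indic_mx_tensor_trig (F : fieldType) n (d : 'I_n -> nat)
    (L : forall i, 'M[F]_(d i)) (S : {set 'I_#|{: multi_index d}|}) :
  down_set S -> (forall i, is_trig_mx (L i)) ->
  indic_mx F S *m tensor L = indic_mx F S *m tensor L *m indic_mx F S.
Proof.
move=> dS tL; apply/matrixP => k l; rewrite mul_indic_mxE indic_mx_mulE !mxE.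
have [kS|] := boolP (k \in S); last by rewrite !mul0r.
have [lS|lS] := boolP (l \in S); first by rewrite mulr1.
have /forallPn[i ki] : ~~ [forall i, component l i <= component k i]%N.
  by apply: contra lS => /forallP lek; apply: dS kS.
rewrite (bigD1 i) //= (is_trig_mxP (tL i)) ?ltnNge //.
by rewrite mul0r mulr0 mul0r.
Qed.

Lemma indic_mx_tensor_trigT (F : fieldType) n (d : 'I_n -> nat)
    (U : forall i, 'M[F]_(d i)) (T : {set 'I_#|{: multi_index d}|}) :
  down_set T -> (forall i, is_trig_mx (U i)^T) ->
  tensor U *m indic_mx F T = indic_mx F T *m (tensor U *m indic_mx F T).
Proof.
move=> dT tU; apply: trmx_inj; rewrite !trmx_mul tr_diag_mx tensor_tr.
exact: indic_mx_tensor_trig.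
Qed.

(** Triangularity allows both projections to be inserted between [tensor L] and [tensor U], where
    they multiply to the projection on [S :&: T]. *)
Lemma rank_indic_mx_tensor_LU (F : fieldType) n (d : 'I_n -> nat)
    (M L U : forall i, 'M[F]_(d i)) (S T : {set 'I_#|{: multi_index d}|}) :
  (forall i, [/\ M i = L i *m U i, is_trig_mx (L i) & is_trig_mx (U i)^T]) ->
  down_set S -> down_set T ->
  (\rank (indic_mx F S *m tensor M *m indic_mx F T) <= #|S :&: T|)%N.
Proof.
move=> LU dS dT.
have -> : tensor M = tensor L *m tensor U.
  rewrite tensorM; apply/matrixP => k l; rewrite !mxE.
  by apply: eq_bigr => i _; case: (LU i) => ->.
rewrite mulmxA indic_mx_tensor_trig //; last by move=> i; case: (LU i).
rewrite -(mulmxA _ (tensor U)) indic_mx_tensor_trigT //; last first.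
  by move=> i; case: (LU i).
rewrite mulmxA -(mulmxA _ (indic_mx F S)) indic_mxM.
rewrite (leq_trans (mxrankM_maxl _ _)) // (leq_trans (mxrankM_maxr _ _)) //.
exact: rank_indic_mx.
Qed.

(** [M i] itself may lack an LU decomposition, but it is the value at 0 of [char_poly_mx (- M i)],
    which has one over the fraction field; evaluation cannot raise the rank. *)
Lemma rank_indic_mx_tensor (F : fieldType) n (d : 'I_n -> nat)
    (M : forall i, 'M[F]_(d i)) (S T : {set 'I_#|{: multi_index d}|}) :
  down_set S -> down_set T ->
  (\rank (indic_mx F S *m tensor M *m indic_mx F T) <= #|S :&: T|)%N.
Proof.
move=> dS dT.
have /fin_all_exists[L /fin_all_exists[U LU]] :=
  fun i => char_poly_mx_LU (- M i).
pose X := indic_mx {poly F} S *m tensor (fun i => char_poly_mx (- M i))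
  *m indic_mx {poly F} T.
have X0 : map_mx (horner_eval 0) X = indic_mx F S *m tensor M *m indic_mx F T.
  rewrite !map_mxM !indic_mx_map tensor_map; congr (_ *m _ *m _).
  apply/matrixP => k l; rewrite !mxE; apply: eq_bigr => i _.
  by rewrite char_poly_mx_eval0 opprK.
rewrite -X0; apply: leq_trans (rank_eval0 X) _.
rewrite !map_mxM !indic_mx_map tensor_map.
exact: (rank_indic_mx_tensor_LU LU dS dT).
Qed.

End RankBound.

(** * Trace inequalities and pairs of orthogonal projections *)

Section Trace.
Variable C : numClosedFieldType.

Lemma adjM m n p (A : 'M[C]_(m, n)) (B : 'M[C]_(n, p)) :
  (A *m B)^t* = B^t* *m A^t*.
Proof. by rewrite trmx_mul map_mxM. Qed.

Lemma adjD m n (A B : 'M[C]_(m, n)) : (A + B)^t* = A^t* + B^t*.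
Proof. by rewrite linearD /= map_mxD. Qed.

Lemma adjB m n (A B : 'M[C]_(m, n)) : (A - B)^t* = A^t* - B^t*.
Proof. by rewrite linearB /= map_mxB. Qed.

Lemma adj1 n : (1%:M : 'M[C]_n)^t* = 1%:M.
Proof. by rewrite trmx1 map_mx1. Qed.

Lemma unitarymxK n (U : 'M[C]_n) : U \is unitarymx -> U^t* *m U = 1%:M.
Proof. by move=> uU; apply: mulmx1C; apply/unitarymxP. Qed.

Definition colnorm2 k N (Y : 'M[C]_(k, N)) (x : 'I_N) : C :=
  \sum_j `|Y j x| ^+ 2.

Lemma colnorm2_ge0 k N (Y : 'M[C]_(k, N)) x : 0 <= colnorm2 Y x.
Proof. by apply: sumr_ge0 => j _; rewrite exprn_ge0. Qed.

Lemma trace_diag k N (Y : 'M[C]_(k, N)) (v : 'rV[C]_N) :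
  \tr (Y *m diag_mx v *m Y^t*) = \sum_x v 0 x * colnorm2 Y x.
Proof.
rewrite /mxtrace; under eq_bigr do rewrite mxE.
rewrite exchange_big /=; apply: eq_bigr => x _; rewrite mulr_sumr.
apply: eq_bigr => j _; rewrite mul_mx_diag !mxE.
by rewrite mulrAC mulrC normCK.
Qed.

(** Matrix form of [2 Re (z conj(w)) <= |z|^2 + |w|^2]: expand the nonnegative trace of [Y D Y^*]
    with [Y = P U^* - Q V^*] and [D = diag_mx v]. *)
Lemma trace_cross_le k m (P Q : 'M[C]_(k, m)) (U V : 'M[C]_m) (v : 'rV[C]_m) :
  (forall i, 0 <= v 0 i) ->
  \tr (P *m (U^t* *m diag_mx v *m V) *m Q^t*)
  + \tr (Q *m (U^t* *m diag_mx v *m V)^t* *m P^t*)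
  <= \tr (P *m (U^t* *m diag_mx v *m U) *m P^t*)
     + \tr (Q *m (V^t* *m diag_mx v *m V) *m Q^t*).
Proof.
move=> v0; rewrite -subr_ge0.
have adj_v : (diag_mx v)^t* = diag_mx v.
  apply/matrixP => i j; rewrite !mxE rmorphMn /= eq_sym.
  by case: eqVneq => [->|_]; rewrite ?mulr0n // (CrealP (ger0_real _)).
have : 0 <= \tr ((P *m U^t* - Q *m V^t*) *m diag_mx v *m (P *m U^t* - Q *m V^t*)^t*).
  rewrite trace_diag sumr_ge0 // => x _.
  by rewrite mulr_ge0 ?colnorm2_ge0.
rewrite adjB !adjM !trmxCK adj_v !(mulmxDr, mulmxDl, mulmxN, mulNmx) !mulmxA.
rewrite opprK !(mxtraceD, raddfN) /=.
by congr (_ <= _); ring.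
Qed.

(** Twice [s] is a sum of cross terms; these are bounded by one trace in [P] and one in [Q], each at
    most [t]. *)
Lemma le_trace_of_cross k m (P Q : 'M[C]_(k, m)) (A B A1 A2 B1 B2 : 'M[C]_m) (s t : C) :
  \tr (P *m (A + B) *m Q^t*) = s -> \tr (Q *m (A + B)^t* *m P^t*) = s ->
  \tr (P *m A *m Q^t*) + \tr (Q *m A^t* *m P^t*)
    <= \tr (P *m A1 *m P^t*) + \tr (Q *m A2 *m Q^t*) ->
  \tr (P *m B *m Q^t*) + \tr (Q *m B^t* *m P^t*)
    <= \tr (P *m B1 *m P^t*) + \tr (Q *m B2 *m Q^t*) ->
  \tr (P *m (A1 + B1) *m P^t*) <= t -> \tr (Q *m (A2 + B2) *m Q^t*) <= t ->
  s <= t.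
Proof.
rewrite adjD !mulmxDr !mulmxDl !mxtraceD => sP sQ cA cB tP tQ.
rewrite -(ler_pM2l (ltr0Sn _ 1)) !mulr_natl !mulr2n -[X in X + _]sP -[X in _ + X]sQ.
rewrite addrACA; apply: le_trans (lerD cA cB) _.
by rewrite addrACA lerD.
Qed.

Lemma trace_gram k N (Y : 'M[C]_(k, N)) :
  \tr (Y *m Y^t*) = \sum_x colnorm2 Y x.
Proof.
rewrite -[Y in Y *m _]mulmx1 -diag_const_mx trace_diag.
by apply: eq_bigr => x _; rewrite mxE mul1r.
Qed.

Lemma trace_gram_ge0 k N (Y : 'M[C]_(k, N)) : 0 <= \tr (Y *m Y^t*).
Proof. by rewrite trace_gram sumr_ge0 // => x _; apply: colnorm2_ge0. Qed.

Definition orthoproj N (E : 'M[C]_N) := E *m E = E /\ E^t* = E.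

Lemma trace_proj_ge0 k N (P : 'M[C]_(k, N)) (E : 'M[C]_N) :
  orthoproj E -> 0 <= \tr (P *m E *m P^t*).
Proof.
move=> [EE Eh]; rewrite -[in X in \tr X]EE mulmxA -mulmxA.
by rewrite -[X in _ *m (X *m _)]Eh -adjM trace_gram_ge0.
Qed.

Lemma orthoproj1B N (E : 'M[C]_N) : orthoproj E -> orthoproj (1%:M - E).
Proof.
move=> [EE Eh]; split; last by rewrite adjB adj1 Eh.
by rewrite mulmxBl mul1mx mulmxBr mulmx1 EE subrr subr0.
Qed.

Lemma orthoprojD N (E F : 'M[C]_N) :
  orthoproj E -> orthoproj F -> E *m F = 0 -> orthoproj (E + F).
Proof.
move=> [EE Eh] [FF Fh] EF; split; last by rewrite adjD Eh Fh.
have FE : F *m E = 0 by rewrite -Eh -Fh -adjM EF trmx0 map_mx0.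
by rewrite mulmxDl !mulmxDr EE FF EF FE addr0 add0r.
Qed.

Lemma orthoproj_gram r N (B : 'M[C]_(r, N)) :
  B \is unitarymx -> orthoproj (B^t* *m B).
Proof.
move=> /unitarymxP uB; split; last by rewrite adjM trmxCK.
by rewrite mulmxA -(mulmxA _ B) uB mulmx1.
Qed.

(** With [Q] as below, [E + (G - Q)] is again a projection and contributes at most [k]; the
    remaining [Q] contributes at most its own trace, the rank. *)
Lemma trace_two_proj k N (P : 'M[C]_(k, N)) (E G : 'M[C]_N) :
  P \is unitarymx -> orthoproj E -> orthoproj G ->
  \tr (P *m E *m P^t*) + \tr (P *m G *m P^t*) <= (k + \rank (E *m G))%:R.
Proof.
move=> uP pE pG; set r := \rank _.
have [EE Eh] := pE; have [GG Gh] := pG.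
(* Q projects onto the row space of EG, so that Q <= G and E(G - Q) = 0 *)
pose B := schmidt (row_base (E *m G)).
have rN : (r <= N)%N by apply: rank_leq_row.
have uB : B \is unitarymx by rewrite schmidt_unitarymx.
have eB : (B :=: E *m G)%MS.
  apply: eqmx_trans (eq_row_base _).
  by apply: eqmx_schmidt_free; apply: row_base_free.
pose Q := B^t* *m B.
have pQ : orthoproj Q by apply: orthoproj_gram.
have [QQ Qh] := pQ.
have BG : B *m G = B.
  have /submxP[Y ->] : (B <= E *m G)%MS by rewrite eB.
  by rewrite -!mulmxA GG.
have EGQ : E *m G *m Q = E *m G.
  have /submxP[Y ->] : (E *m G <= B)%MS by rewrite eB.
  by rewrite /Q -mulmxA (mulmxA B) (unitarymxP uB) mul1mx.
have QG : Q *m G = Q by rewrite /Q -mulmxA BG.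
have GQ : G *m Q = Q by rewrite -Gh -[in LHS]Qh -adjM QG Qh.
have pGQ : orthoproj (G - Q).
  split; last by rewrite adjB Gh Qh.
  by rewrite mulmxBl !mulmxBr GG QG GQ QQ subrr subr0.
have EGQ0 : E *m (G - Q) = 0.
  by rewrite mulmxBr -EGQ -mulmxA GQ subrr.
have := trace_proj_ge0 P (orthoproj1B (orthoprojD pE pGQ EGQ0)).
have := trace_proj_ge0 B (orthoproj1B (orthoproj_gram uP)).
rewrite !(mulmxDr, mulmxDl, mulmxN, mulNmx, mulmx1) !opprD opprK.
rewrite (unitarymxP uP) (unitarymxP uB) !(mxtraceD, raddfN) /= !mxtrace1.
(* Cyclicity turns the compression of [Q] to [P] into that of the projection [P^* P] to [B], which
   [hB] bounds by [r]. *)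
have -> : \tr (P *m Q *m P^t*) = \tr (B *m (P^t* *m P) *m B^t*).
  by rewrite /Q mulmxA -mulmxA mxtrace_mulC !mulmxA.
rewrite subr_ge0 natrD -/r => hB hP.
rewrite -subr_ge0 in hB; rewrite -subr_ge0; have := addr_ge0 hP hB.
by congr (_ <= _); ring.

Qed.

Lemma orthoproj_indic_mx N (W : 'M[C]_N) (S : {set 'I_N}) :
  W \is unitarymx -> orthoproj (W^t* *m indic_mx C S *m W).
Proof.
move=> uW; split; last first.
  rewrite !adjM trmxCK mulmxA tr_diag_mx; congr (_ *m _ *m _).
  by apply/matrixP => i j; rewrite !mxE rmorphMn /= rmorph_nat.
rewrite !mulmxA -(mulmxA _ W) (unitarymxP uW) mulmx1.
by rewrite -(mulmxA _ (indic_mx C S) (indic_mx C S)) indic_mxM setIid.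
Qed.

Lemma colnorm2_indic_mx k N (P : 'M[C]_(k, N)) (W : 'M[C]_N) (S : {set 'I_N}) :
  \tr (P *m (W^t* *m indic_mx C S *m W) *m P^t*)
  = \sum_(x in S) colnorm2 (P *m W^t*) x.
Proof.
have -> : P *m (W^t* *m indic_mx C S *m W) *m P^t*
    = P *m W^t* *m indic_mx C S *m (P *m W^t*)^t*.
  by rewrite adjM trmxCK !mulmxA.
rewrite trace_diag [RHS]big_mkcond; apply: eq_bigr => x _.
by rewrite mxE; case: (x \in S); rewrite ?mul1r ?mul0r.
Qed.

Lemma sum_colnorm2 k N (P : 'M[C]_(k, N)) (W : 'M[C]_N) :
  P \is unitarymx -> W \is unitarymx ->
  \sum_x colnorm2 (P *m W^t*) x = k%:R.
Proof.
move=> uP uW; rewrite -trace_gram adjM trmxCK mulmxA -(mulmxA P).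
by rewrite unitarymxK // mulmx1 (unitarymxP uP) mxtrace1.
Qed.

Lemma tensor_adj n (d : 'I_n -> nat) (A : forall i, 'M[C]_(d i)) :
  (tensor A)^t* = tensor (fun i => (A i)^t*).
Proof. by rewrite tensor_tr tensor_map. Qed.

Lemma tensor_unitary n (d : 'I_n -> nat) (U : forall i, 'M[C]_(d i)) :
  (forall i, U i \is unitarymx) -> tensor U \is unitarymx.
Proof.
move=> uU; apply/unitarymxP; rewrite tensor_adj tensorM -tensor1.
apply/matrixP => k l; rewrite !mxE.
by apply: eq_bigr => i _; rewrite (unitarymxP (uU i)).
Qed.

(** In the product of the two projections the outer factors cannot raise the rank; the core is the
    transition matrix, the tensor product of the [U i *m (V i)^t*], cut down to [S] and [T]. *)
Lemma colnorm2_down_sets k n (d : 'I_n -> nat) (U V : forall i, 'M[C]_(d i))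
    (P : 'M[C]_(k, #|{: multi_index d}|)) S T :
  (forall i, U i \is unitarymx) -> (forall i, V i \is unitarymx) ->
  P \is unitarymx -> down_set S -> down_set T ->
  \sum_(x in S) colnorm2 (P *m (tensor U)^t*) x
  + \sum_(x in T) colnorm2 (P *m (tensor V)^t*) x <= (k + #|S :&: T|)%:R.
Proof.
move=> uU uV uP dS dT.
have uTU := tensor_unitary uU; have uTV := tensor_unitary uV.
rewrite -!colnorm2_indic_mx.
have := trace_two_proj uP (orthoproj_indic_mx S uTU) (orthoproj_indic_mx T uTV).
move/le_trans; apply; rewrite ler_nat leq_add2l.
rewrite !mulmxA (leq_trans (mxrankM_maxl _ _)) // -!mulmxA.
rewrite (leq_trans (mxrankM_maxr _ _)) //.
rewrite (mulmxA (tensor U)) tensor_adj tensorM mulmxA.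
exact: rank_indic_mx_tensor.
Qed.

End Trace.

(** * Layer-cake decompositions of finite families of reals *)

Section LayerCake.
Variable R : realFieldType.
Implicit Types (a g u v m : R) (s : seq R) (ws : seq (R * R)).

(** Each layer in [ws] pairs a height with the threshold at which it is gained; [m] is the base
    level. *)
Definition layered ws m : pred R :=
  fun a => a == m + \sum_(w <- ws) w.1 * (w.2 <= a)%R%:R.

Lemma layered_path m s : path <%R m s ->
  exists ws, [/\ all (fun w => 0 <= w.1) ws, all (fun w => m < w.2) ws &
                 all (layered ws m) (m :: s)].
Proof.
elim: s m => [|v s IHs] m /=.
  by exists [::]; rewrite /= /layered big_nil addr0 eqxx.
move=> /andP[mv /IHs[ws [w0 wv wl]]].
(* The new layer is the gap between the two least values; all thresholds exceed [m], so [m] itself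
   gains no layer. *)
exists ((v - m, v) :: ws); split; first by rewrite /= subr_ge0 ltW.
  by rewrite /= mv; apply: sub_all wv => w; apply: lt_trans.
apply/andP; split.
  rewrite /layered big_cons /= leNgt mv mulr0 add0r big_seq big1 ?addr0 //.
  by move=> w /(allP wv) vw; rewrite leNgt (lt_trans mv vw) mulr0.
change (all (layered ((v - m, v) :: ws) m) (v :: s)).
apply/allP => a a_s; rewrite /layered big_cons /=.
have va : v <= a.
  move: a_s (allP wl a a_s); rewrite inE => _ /eqP->.
  by rewrite lerDl big_seq sumr_ge0 // => w /(allP w0) ?; rewrite mulr_ge0 ?ler0n.
by rewrite va mulr1 addrA subrKC; apply: (allP wl).
Qed.

Lemma layer_cake s :
  exists ws m, all (fun w => 0 <= w.1) ws /\ {in s, forall a,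
    a = m + \sum_(w <- ws) w.1 * (w.2 <= a)%R%:R}.
Proof.
case: s => [|v s]; first by exists [::], 0.
have : sorted <%R (sort <=%R (undup (v :: s))).
  by rewrite sort_lt_sorted undup_uniq.
have mem_s a : (a \in sort <=%R (undup (v :: s))) = (a \in v :: s).
  by rewrite mem_sort mem_undup.
case: (sort _ _) mem_s => [/(_ v)|m s' mem_s]; first by rewrite mem_head.
move=> /layered_path[ws [w0 _ /allP wl]].
by exists ws, m; split=> // a; rewrite -mem_s => /wl /eqP.
Qed.

(** If [g <= a], the bases and the layers gained by [g] cancel in [a - g]; if [a < g], no layer is
    gained by [a] alone. *)
Lemma layer_cake_pos ws m a g :
  a = m + \sum_(w <- ws) w.1 * (w.2 <= a)%R%:R ->
  g = m + \sum_(w <- ws) w.1 * (w.2 <= g)%R%:R ->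
  Num.max (a - g) 0 = \sum_(w <- ws) w.1 * ((w.2 <= a)%R && (g < w.2)%R)%:R.
Proof.
move=> ea eg; have [ga|ag] := leP g a; last first.
  rewrite max_r ?subr_le0 1?ltW // big1 // => w _.
  have [wa|_] := leP w.2 a; last by rewrite mulr0.
  by rewrite ltNge (le_trans wa (ltW ag)) mulr0.
rewrite max_l ?subr_ge0 // [X in X - g]ea [X in _ - X = _]eg.
rewrite opprD addrACA subrr add0r -sumrB.
apply: eq_bigr => w _; rewrite -mulrBr; congr (_ * _).
have [wg|gw] := leP w.2 g; first by rewrite (le_trans wg ga) /= subrr.
by rewrite subr0 andbT.
Qed.

(* Layer cake: put [ga := t - be].  As p and q have the same total, the hypothesis
   says p(al >= s) - q(ga >= s) <= #(al >= s > ga); integrate over s. *)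
Lemma weighted_sum_le_level_sets (I : finType) (p q al be : I -> R) (K t : R) :
  \sum_x p x = K -> \sum_x q x = K ->
  (forall u v, \sum_(x | u <= al x) p x + \sum_(x | v < be x) q x
     <= K + #|[set x | (u <= al x) && (v < be x)]|%:R) ->
  \sum_x (al x * p x + be x * q x)
  <= K * t + \sum_x Num.max (al x + be x - t) 0.
Proof.
move=> sp sq H; pose ga x := t - be x.
(* One family of layers serves both functions, so that they can be compared threshold by
   threshold. *)
have [ws [m [w0 wE]]] := layer_cake ([seq al x | x : I] ++ [seq ga x | x : I]).
have alE x : al x = m + \sum_(w <- ws) w.1 * (w.2 <= al x)%R%:R.
  by apply: wE; rewrite mem_cat map_f ?mem_enum.
have gaE x : ga x = m + \sum_(w <- ws) w.1 * (w.2 <= ga x)%R%:R.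
  by apply: wE; rewrite mem_cat orbC map_f ?mem_enum.
(* As [q] has total [K], replacing [be] by [t - ga] splits off [K * t]. *)
have -> : \sum_x (al x * p x + be x * q x)
    = K * t + (\sum_x al x * p x - \sum_x ga x * q x).
  rewrite -[in RHS]sq mulr_suml addrA addrAC -sumrB -big_split /=.
  by apply: eq_bigr => x _; rewrite /ga; ring.
rewrite lerD2l.
have lay (f r : I -> R) :
    (forall x, f x = m + \sum_(w <- ws) w.1 * (w.2 <= f x)%R%:R) ->
    \sum_x f x * r x = m * (\sum_x r x)
      + \sum_(w <- ws) w.1 * (\sum_(x | w.2 <= f x) r x).
  move=> fE; under eq_bigr do rewrite fE mulrDl mulr_suml.
  rewrite big_split /= -mulr_sumr exchange_big /=; congr (_ + _).
  apply: eq_bigr => w _; rewrite [X in _ = _ * X]big_mkcond mulr_sumr.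
  apply: eq_bigr => x _; rewrite -mulrA; congr (_ * _).
  by case: (_ <= _); rewrite ?mul1r ?mul0r.
rewrite (lay al) // (lay ga) // sp sq opprD addrACA subrr add0r -sumrB.
under [leRHS]eq_bigr => x _.
  rewrite (_ : _ - t = al x - ga x); last by rewrite /ga opprB addrA.
  rewrite (layer_cake_pos (alE x) (gaE x)); over.
rewrite exchange_big /= big_seq [leRHS]big_seq; apply: ler_sum => w /(allP w0) w_ge0.
rewrite -mulrBr -mulr_sumr ler_wpM2l //.
have gabe x : (ga x < w.2) = (t - w.2 < be x) by rewrite /ga ltrBlDr addrC ltrBlDr.
have := H w.2 (t - w.2).
(* The total [K] of [q] splits at [ga x = w.2]; the part with [ga x < w.2], that is
   [t - w.2 < be x], cancels on both sides. *)
rewrite -sq [in X in _ <= X + _](bigID (fun x => w.2 <= ga x)) /=.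
under [in X in _ <= _ + X + _ -> _]eq_bigl do rewrite -ltNge gabe.
rewrite addrAC lerD2r -lerBlDl => /le_trans; apply.
rewrite -sum1dep_card natr_sum big_mkcond /=; apply: ler_sum => x _.
by rewrite gabe; case: (_ && _).
Qed.

End LayerCake.

(** * Decreasing rearrangement and sums of largest entries *)

Section Decreasing.
Variable R : realType.

Lemma perm_decreasing N (x : 'rV[R]_N) :
  perm_eq [seq decreasing x 0 i | i : 'I_N] [seq x 0 i | i : 'I_N].
Proof.
have <- : sort >=%R [seq x 0 j | j : 'I_N] = [seq decreasing x 0 i | i : 'I_N].
  apply: (@eq_from_nth _ 0) => [|i].
    by rewrite size_sort !size_map.
  rewrite size_sort size_map size_enum_ord => iN.
  by rewrite (nth_map (Ordinal iN)) ?size_enum_ord // mxE nth_enum_ord.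
by rewrite perm_sort.
Qed.

Lemma sum_decreasing N (x : 'rV[R]_N) (f : R -> R) :
  \sum_i f (decreasing x 0 i) = \sum_i f (x 0 i).
Proof.
transitivity (\sum_(y <- [seq decreasing x 0 i | i : 'I_N]) f y).
  by rewrite big_image.
by rewrite (perm_big _ (perm_decreasing x)) big_image.
Qed.

Lemma decreasing_nonincr N (x : 'rV[R]_N) (i j : 'I_N) :
  (i <= j)%N -> decreasing x 0 j <= decreasing x 0 i.
Proof.
move=> ij; rewrite !mxE.
set s := sort _ _.
have ss : sorted >=%R s by apply: sort_sorted => a b; apply: ge_total.
apply: (sorted_leq_nth ge_trans ge_refl 0 ss) => //;
  by rewrite inE size_sort size_map size_enum_ord.
Qed.

Lemma decreasing_id N (x : 'rV[R]_N) :
  (forall i j : 'I_N, (i <= j)%N -> x 0 j <= x 0 i) -> decreasing x = x.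
Proof.
move=> dx; apply/rowP => i; rewrite mxE sorted_sort.
- by rewrite (nth_map i) ?size_enum_ord // nth_ord_enum.
- exact: ge_trans.
rewrite sorted_pairwise; last exact: ge_trans.
rewrite pairwise_map.
apply: sub_pairwise (_ : pairwise (fun i j : 'I_N => (i <= j)%N) _).
  by move=> j k; apply: dx.
rewrite -sorted_pairwise; last by move=> ? ? ?; apply: leq_trans.
have : sorted leq (map val (enum 'I_N)) by rewrite val_enum_ord iota_sorted.
by rewrite sorted_map.
Qed.

Lemma decreasingK N (x : 'rV[R]_N) : decreasing (decreasing x) = decreasing x.
Proof. by apply: decreasing_id => i j; apply: decreasing_nonincr. Qed.

(** For [t] the [k]-th largest entry, each of the first [k] entries is [t] plus its excess, and the
    later ones have no excess. *)
Lemma sum_top_decreasing N (x : 'rV[R]_N) (k : nat) : (0 < k <= N)%N ->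
  exists t, \sum_(i < N | (i < k)%N) decreasing x 0 i
    = k%:R * t + \sum_i Num.max (x 0 i - t) 0.
Proof.
(* Indices start at 0: after the case split, position [k] holds the last of the [k.+1] entries
   summed. *)
case: k => // k /= kN; set t := decreasing x 0 (Ordinal kN); exists t.
rewrite -(sum_decreasing x (fun y => Num.max (y - t) 0)).
have -> : k.+1%:R * t = \sum_(i < N | (i < k.+1)%N) t.
  by rewrite (big_ord_narrow kN) sumr_const card_ord mulr_natl.
rewrite [X in _ = _ + X](bigID (fun i : 'I_N => (i < k.+1)%N)) /=.
rewrite [X in _ = _ + (_ + X)]big1 => [|i]; last first.
  by rewrite -leqNgt => ki; rewrite max_r // subr_le0 decreasing_nonincr // ltnW.
rewrite addr0 -big_split /=; apply: eq_bigr => i ik.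
by rewrite max_l ?subr_ge0 ?decreasing_nonincr // subrKC.
Qed.

End Decreasing.

(** * Spectral decomposition with sorted eigenvalues *)

Section Spectral.
Variable R : realType.
Local Notation C := R[i].

Definition real_diag N (v : 'rV[R]_N) : 'M[C]_N :=
  diag_mx (map_mx (real_complex R) v).

Lemma adj_real_diag N (v : 'rV[R]_N) : (real_diag v)^t* = real_diag v.
Proof.
apply/matrixP => i j; rewrite !mxE rmorphMn /= eq_sym.
have [->|_] := eqVneq i j; last by rewrite !mulr0n.
by congr (_ *+ _); apply/CrealP; apply/complex_realP; exists (v 0 j).
Qed.

Lemma hermsymP N (X : 'M[C]_N) : reflect (X^t* = X) (X \is hermsymmx).
Proof.
apply: (iffP (is_hermitianmxP _ _ _)); rewrite expr0 scale1r => e.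
  by rewrite -e.
by rewrite e.
Qed.

Lemma unitary_rowsub m n k (f : 'I_k -> 'I_m) (U : 'M[C]_(m, n)) :
  injective f -> U \is unitarymx -> rowsub f U \is unitarymx.
Proof.
move=> f_inj /unitarymxP uU; apply/unitarymxP/matrixP => i j.
rewrite !mxE -(inj_eq f_inj); have /matrixP/(_ (f i) (f j)) := uU.
by rewrite !mxE => <-; apply: eq_bigr => x _; rewrite !mxE.
Qed.

Lemma char_poly_unitary N (W D : 'M[C]_N) :
  W \is unitarymx -> char_poly (invmx W *m D *m W) = char_poly D.
Proof.
move=> /unitarymx_unit uW; rewrite /char_poly /char_poly_mx.
have uX : map_mx polyC W \in unitmx.
  by rewrite unitmxE det_map_mx rmorph_unit // -unitmxE.
have -> : 'X%:M - map_mx polyC (invmx W *m D *m W)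
    = invmx (map_mx polyC W) *m ('X%:M - map_mx polyC D) *m map_mx polyC W.
  rewrite !map_mxM map_invmx mulmxBr mulmxBl scalar_mxC -(mulmxA _ (invmx _)).
  by rewrite mulVmx // mulmx1.
by rewrite !det_mulmx mulrAC -det_mulmx mulVmx // det1 mul1r.
Qed.

(** Both lists are the roots, with multiplicity, of one characteristic polynomial. *)
Lemma perm_eigenvalues N (W : 'M[C]_N) (v : 'rV[C]_N) : W \is unitarymx ->
  perm_eq (eigenvalues (invmx W *m diag_mx v *m W)) [seq v 0 i | i : 'I_N].
Proof.
move=> uW; apply: prod_XsubC_eq; rewrite /eigenvalues.
case: closed_field_poly_normal => r /= er.
rewrite (monicP (char_poly_monic _)) scale1r in er; rewrite -er.
rewrite char_poly_unitary // char_poly_trig ?diag_mx_is_trig // big_image.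
by apply: eq_bigr => i _; rewrite mxE eqxx.
Qed.

Lemma lambda_decreasing N (X : 'M[C]_N) : decreasing (lambda X) = lambda X.
Proof. exact: decreasingK. Qed.

Lemma lambda_nonincr N (X : 'M[C]_N) (i j : 'I_N) : (i <= j)%N ->
  lambda X 0 j <= lambda X 0 i.
Proof. exact: decreasing_nonincr. Qed.

(** The spectral theorem gives a real diagonal in unspecified order; permuting the rows of the
    unitary matrix sorts it. *)
Lemma lambda_spectral N (X : 'M[C]_N) : X \is hermsymmx ->
  exists2 W : 'M[C]_N, W \is unitarymx &
    X = W^t* *m real_diag (lambda X) *m W.
Proof.
move=> hX; have sp_real := hermitian_spectral_diag_real hX.
have /hermitian_normalmx /orthomx_spectralP eX := hX.
set P := spectralmx X in eX; set v := spectral_diag X in eX sp_real.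
have uP : P \is unitarymx by apply: spectral_unitarymx.
have pe := perm_eigenvalues v uP; rewrite -eX in pe.
have szE : size (eigenvalues X) = N.
  by rewrite (perm_size pe) size_image card_ord.
have pl : perm_eq [seq lambda X 0 i | i : 'I_N]
    [seq complex.Re (v 0 i) | i : 'I_N].
  apply: perm_trans (perm_decreasing _) _.
  have -> : [seq complex.Re (v 0 i) | i : 'I_N]
      = map (@complex.Re R) [seq v 0 i | i : 'I_N] by rewrite -map_comp.
  apply: perm_trans (perm_map _ pe).
  suff -> : [seq (\row_(i < N) complex.Re (eigenvalues X)`_i) 0 i | i : 'I_N]
     = map (@complex.Re R) (eigenvalues X) by [].
  apply: (@eq_from_nth _ 0) => [|i].
    by rewrite size_image card_ord size_map szE.
  rewrite size_image card_ord => iN.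
  rewrite (nth_map (Ordinal iN)) ?size_enum_ord // mxE nth_enum_ord //.
  by rewrite (nth_map 0) // szE.
have [s es] : exists s : 'S_N, forall i, lambda X 0 i = complex.Re (v 0 (s i)).
  have /tuple_permP[s es] : perm_eq [tuple lambda X 0 i | i < N]
      [tuple complex.Re (v 0 i) | i < N] by [].
  exists s => i; have := congr1 (fun t : N.-tuple R => tnth t i) (val_inj es).
  by rewrite !tnth_mktuple.
exists (rowsub s P); first by apply: unitary_rowsub => //; apply: perm_inj.
rewrite [LHS]eX invmx_unitary //; apply/matrixP => a b.
rewrite /real_diag !mul_mx_diag !mxE (reindex_inj (@perm_inj _ s)).
apply: eq_bigr => i _.
rewrite [X in _ = X * _]mxE [map_mx _ _ 0 i]mxE es RRe_real ?mxE ?mxE //.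
by have /mxOverP := sp_real; apply.
Qed.

End Spectral.

(** * Singular value decomposition *)

Section Singular.
Variable R : realType.
Local Notation C := R[i].

Lemma lambda_ge0 N (X : 'M[C]_N) i : psd X -> 0 <= lambda X 0 i.
Proof.
move=> [hX pX]; have [W uW eX] := lambda_spectral hX.
(* The quadratic form is evaluated at an eigenvector, the adjoint of row [i] of [W]. *)
rewrite -ler0c; have := pX ((row i W)^t*).
rewrite trmxCK -row_mul.
have -> : (row i (W *m X) *m (row i W)^t*) 0 0 = (W *m X *m W^t*) i i.
  by rewrite !mxE; apply: eq_bigr => k _; rewrite !mxE.
rewrite {1}eX !mulmxA (unitarymxP uW) mul1mx -mulmxA (unitarymxP uW) mulmx1.
by rewrite 2!mxE eqxx.
Qed.

Lemma psd_gram N (A : 'M[C]_N) : psd (A^t* *m A).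
Proof.
split=> [|v]; first by apply/hermsymP; rewrite adjM trmxCK.
rewrite mulmxA -adjM -mulmxA mxE sumr_ge0 // => i _.
by rewrite !mxE -normCKC exprn_ge0.
Qed.

Lemma sigma_ge0 N (A : 'M[C]_N) i : 0 <= sigma A 0 i.
Proof. by rewrite mxE sqrtr_ge0. Qed.

Lemma sigma_nonincr N (A : 'M[C]_N) (i j : 'I_N) : (i <= j)%N ->
  sigma A 0 j <= sigma A 0 i.
Proof. by move=> ij; rewrite mxE [leRHS]mxE ler_wsqrtr // lambda_nonincr. Qed.

Lemma sigma_sqr N (A : 'M[C]_N) i : sigma A 0 i ^+ 2 = lambda (A^t* *m A) 0 i.
Proof. by rewrite mxE sqr_sqrtr // lambda_ge0 //; apply: psd_gram. Qed.

(* The Gram-Schmidt factorisation Y = L S has L lower triangular and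
   L L^* diagonal; sortedness of the diagonal forces L to be diagonal. *)
Lemma orthogonal_rows_factor N (Y : 'M[C]_N) (s : 'rV[R]_N) :
  (forall i, 0 <= s 0 i) ->
  (forall i j : 'I_N, (i <= j)%N -> s 0 j <= s 0 i) ->
  Y *m Y^t* = real_diag (map_mx (fun x => x ^+ 2) s) ->
  exists2 S : 'M[C]_N, S \is unitarymx & Y = real_diag s *m S.
Proof.
move=> s0 s_noninc YY; pose S := schmidt Y.
have uS : S \is unitarymx by apply: schmidt_unitarymx.
pose L := Y *m S^t*.
have eY : Y = L *m S by rewrite /L -mulmxA unitarymxK // mulmx1.
have LL : L *m L^t* = real_diag (map_mx (fun x => x ^+ 2) s).
  by rewrite /L adjM trmxCK mulmxA -(mulmxA Y) unitarymxK // mulmx1.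
(* Row [i] of [Y] lies in the span of the rows of [S] up to [i], which are orthogonal to row [j]. *)
have trL (i j : 'I_N) : (i < j)%N -> L i j = 0.
  move=> ij.
  have -> : L i j = (row i Y *m (row j S)^t*) 0 0.
    by rewrite /L !mxE; apply: eq_bigr => k _; rewrite !mxE.
  suff -> : row i Y *m (row j S)^t* = 0 by rewrite mxE.
  have /submxP[x ->] := row_schmidt_sub Y i.
  rewrite -mulmxA.
  suff -> : (\sum_(k < N | (k <= i)%N) <<row k (schmidt Y)>>)%MS *m (row j S)^t* = 0.
    by rewrite mulmx0.
  apply/eqP; rewrite -sub_kermx; apply/sumsmx_subP => k ki.
  rewrite genmxE sub_kermx; apply/eqP/matrixP => u v; rewrite !ord1 !mxE.
  have kj : (k == j) = false.
    by apply/eqP => e; move: ij; rewrite -e ltnNge ki.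
  have /matrixP/(_ k j) := unitarymxP uS; rewrite !mxE kj mulr0n => e.
  rewrite -[RHS]e.
  by apply: eq_bigr => l _; rewrite !mxE.
have dL i : 0 <= L i i.
  have := form1_row_schmidt Y i; rewrite dotmxE.
  congr (_ <= _); rewrite /L !mxE; apply: eq_bigr => k _; rewrite !mxE //.
have LLE i j : \sum_k L i k * (L j k)^* = ((s 0 i ^+ 2) *+ (i == j))%:C.
  have /matrixP/(_ i j) := LL; rewrite !mxE => e.
  by rewrite rmorphMn /= -e; apply: eq_bigr => k _; rewrite !mxE.
(* Strong induction on the column [j]: by then row [j] of [L] is known to be diagonal, and its
   orthogonality to row [i] reads [L i j * conj(L j j) = 0]. *)
have offdiag (i j : 'I_N) : i != j -> L i j = 0.
  have [m] := ubnP (val j); elim: m i j => // m IHm i j /ltnSE jm ij.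
  have [/trL//|ji] := ltnP i j.
  have Lj (k : 'I_N) : k != j -> L j k = 0.
    have [/trL//|kj] := ltnP j k => kNj; apply: IHm; last by rewrite eq_sym.
    by apply: leq_trans jm; rewrite ltn_neqAle kNj kj.
  have := LLE i j; rewrite (negPf ij) mulr0n (bigD1 j) //=.
  rewrite big1 => [|k /Lj->]; last first.
    by rewrite conjC0 mulr0.
  rewrite addr0 => /eqP; rewrite mulf_eq0 conjC_eq0 => /orP[/eqP//|/eqP Ljj].
  (* If [L j j = 0], then [s] vanishes at [j] and, being decreasing, at the later index [i]; row [i]
     of [L] then has norm 0. *)
  have sj : s 0 j = 0.
    have := LLE j j; rewrite eqxx mulr1n (bigD1 j) //= big1 => [|k /Lj->].
      rewrite Ljj mul0r addr0 => /esym/eqP.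
      by rewrite fmorph_eq0 sqrf_eq0 => /eqP.
    by rewrite mul0r.
  have si : s 0 i = 0 by apply/le_anti; rewrite s0 -[X in _ <= X]sj s_noninc.
  have := LLE i i; rewrite si expr0n mul0rn rmorph0 => /eqP.
  rewrite psumr_eq0 => [/allP/(_ j)|k _]; last by rewrite -normCK exprn_ge0.
  rewrite mem_index_enum => /(_ isT); rewrite -normCK sqrf_eq0 normr_eq0.
  by move=> /eqP.
exists S => //; rewrite {1}eY; congr (_ *m S); apply/matrixP => i j.
rewrite /real_diag [RHS]mxE [map_mx _ _ _ _]mxE.
have [<-|ij] := eqVneq i j; last by rewrite offdiag.
have := LLE i i; rewrite eqxx mulr1n (bigD1 i) //= big1 => [|k ki]; last first.
  by rewrite offdiag ?mul0r // eq_sym.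
rewrite addr0 -normCK (ger0_norm (dL i)) rmorphXn /= => /eqP.
by rewrite eqrXn2 ?ler0c // => /eqP.
Qed.

(** The hypothesis makes the rows of [V *m A^t*] orthogonal with norms [s], so
    [orthogonal_rows_factor] yields [U]. *)
Lemma unitary_factor_of_gram N (A V : 'M[C]_N) (s : 'rV[R]_N) :
  V \is unitarymx -> (forall i, 0 <= s 0 i) ->
  (forall i j : 'I_N, (i <= j)%N -> s 0 j <= s 0 i) ->
  A^t* *m A = V^t* *m real_diag (map_mx (fun x => x ^+ 2) s) *m V ->
  exists2 U : 'M[C]_N, U \is unitarymx & A = U^t* *m real_diag s *m V.
Proof.
move=> uV s0 s_noninc eA.
have YY : (V *m A^t*) *m (V *m A^t*)^t* = real_diag (map_mx (fun x => x ^+ 2) s).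
  rewrite adjM trmxCK -mulmxA (mulmxA (A^t*)) eA !mulmxA (unitarymxP uV) mul1mx.
  by rewrite -mulmxA (unitarymxP uV) mulmx1.
have [U uU eU] := orthogonal_rows_factor s0 s_noninc YY.
exists U; first exact: uU.
have <- : A *m V^t* = U^t* *m real_diag s.
  by rewrite -[LHS]trmxCK adjM trmxCK eU adjM adj_real_diag.
by rewrite -mulmxA (unitarymxK uV) mulmx1.
Qed.

Lemma singular_value_decomposition N (A : 'M[C]_N) :
  exists U V : 'M[C]_N, [/\ U \is unitarymx, V \is unitarymx &
    A = U^t* *m real_diag (sigma A) *m V].
Proof.
have [V uV eV] := lambda_spectral (psd_gram A).1.
have sq : lambda (A^t* *m A) = map_mx (fun x => x ^+ 2) (sigma A).
  by apply/rowP => i; rewrite [RHS]mxE sigma_sqr.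
rewrite sq in eV.
have [U uU eU] := unitary_factor_of_gram uV (sigma_ge0 A) (@sigma_nonincr _ A) eV.
by exists U, V; split; [exact: uU | exact: uV | exact: eU].
Qed.

End Singular.

(** * Ky Fan's inequality for tensor products *)

Section TensorMajorization.
Variables (R : realType) (n : nat) (d : 'I_n -> nat).
Local Notation C := R[i].
Local Notation N := #|{: multi_index d}|.
Implicit Types (a b : forall i, 'rV[R]_(d i)) (U V : forall i, 'M[C]_(d i)).

(** Nonnegativity lets monotonicity pass from the factors to their product. *)
Definition nonincr_ge0 m (v : 'rV[R]_m) :=
  (forall i, 0 <= v 0 i)
  /\ (forall i j : 'I_m, (i <= j)%N -> v 0 j <= v 0 i).

Lemma tensor_rv_ge0 a x : (forall i, nonincr_ge0 (a i)) -> 0 <= tensor_rv a 0 x.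
Proof. by move=> a0; rewrite mxE prodr_ge0 // => i _; case: (a0 i). Qed.

Lemma tensor_rv_nonincr a x y : (forall i, nonincr_ge0 (a i)) ->
  (forall i, (component y i <= component x i)%N) ->
  tensor_rv a 0 x <= tensor_rv a 0 y.
Proof.
move=> a0 yx; rewrite !mxE; apply: ler_prod => i _.
by have [ai0 ->] := a0 i; rewrite ?ai0.
Qed.

Lemma tensor_real_diag a :
  tensor (fun i => real_diag (a i)) = real_diag (tensor_rv a).
Proof.
rewrite /real_diag tensor_diag; congr diag_mx; apply/rowP => x.
by rewrite !mxE rmorph_prod; apply: eq_bigr => i _; rewrite mxE.
Qed.

Lemma tensor_decomp U a V :
  tensor (fun i => (U i)^t* *m real_diag (a i) *m V i)
  = (tensor U)^t* *m real_diag (tensor_rv a) *m tensor V.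
Proof. by rewrite -tensor_real_diag tensor_adj !tensorM. Qed.

Lemma trace_unitary_diag m (W : 'M[C]_m) (v : 'rV[R]_m) : W \is unitarymx ->
  \tr (W^t* *m real_diag v *m W) = (\sum_i v 0 i)%:C.
Proof.
move=> uW; rewrite -mulmxA mxtrace_mulC -mulmxA (unitarymxP uW) mulmx1.
by rewrite mxtrace_diag rmorph_sum; apply: eq_bigr => i _; rewrite mxE.
Qed.

Lemma trace_tensor U a : (forall i, U i \is unitarymx) ->
  \tr (tensor (fun i => (U i)^t* *m real_diag (a i) *m U i))
  = (\sum_x tensor_rv a 0 x)%:C.
Proof.
by move=> uU; rewrite tensor_decomp trace_unitary_diag ?tensor_unitary.
Qed.

Lemma trace_tensor_decomp k (P : 'M[C]_(k, N)) U a :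
  \tr (P *m tensor (fun i => (U i)^t* *m real_diag (a i) *m U i) *m P^t*)
  = (\sum_x tensor_rv a 0 x * complex.Re (colnorm2 (P *m (tensor U)^t*) x))%:C.
Proof.
have -> : P *m tensor (fun i => (U i)^t* *m real_diag (a i) *m U i) *m P^t*
   = P *m (tensor U)^t* *m real_diag (tensor_rv a) *m (P *m (tensor U)^t*)^t*.
  by rewrite tensor_decomp adjM trmxCK !mulmxA.
rewrite trace_diag rmorph_sum /=; apply: eq_bigr => x _.
rewrite [map_mx _ _ 0 x]mxE rmorphM /= RRe_real //.
by rewrite ger0_real // colnorm2_ge0.
Qed.

Lemma le_of_complex_sums (I : finType) (S T : {set I}) (P Q : I -> C)
    (p q : I -> R) (m : nat) :
  (forall x, P x = (p x)%:C) -> (forall x, Q x = (q x)%:C) ->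
  \sum_(x in S) P x + \sum_(x in T) Q x <= m%:R ->
  \sum_(x in S) p x + \sum_(x in T) q x <= m%:R.
Proof.
move=> Pp Qq; rewrite (eq_bigr _ (fun x _ => Pp x)) (eq_bigr _ (fun x _ => Qq x)).
rewrite -!(rmorph_sum (real_complex R)) -(rmorphD (real_complex R)).
by rewrite -(rmorph_nat (real_complex R)) lecR.
Qed.

Lemma ky_fan_tensor k (P : 'M[C]_(k, N)) U V a b :
  (0 < k <= N)%N -> P \is unitarymx ->
  (forall i, U i \is unitarymx) -> (forall i, V i \is unitarymx) ->
  (forall i, nonincr_ge0 (a i)) -> (forall i, nonincr_ge0 (b i)) ->
  \tr (P *m (tensor (fun i => (U i)^t* *m real_diag (a i) *m U i)
             + tensor (fun i => (V i)^t* *m real_diag (b i) *m V i)) *m P^t*)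
  <= (\sum_(x < N | (x < k)%N)
        decreasing (tensor_rv a + tensor_rv b) 0 x)%:C.
Proof.
move=> kN uP uU uV a0 b0.
rewrite mulmxDr mulmxDl mxtraceD !trace_tensor_decomp -rmorphD lecR -big_split /=.
(* This [t] turns the sum of the [k] largest entries into the right side of the layer-cake bound. *)
have [t ->] := sum_top_decreasing (tensor_rv a + tensor_rv b) kN.
under [in leRHS]eq_bigr do rewrite [(_ + _ : 'M_(_, _)) _ _]mxE.
pose p W x := complex.Re (colnorm2 (P *m (tensor W)^t*) x).
have pE W x : colnorm2 (P *m (tensor W)^t*) x = (p W x)%:C.
  by rewrite RRe_real // ger0_real // colnorm2_ge0.
have total W : (forall i, W i \is unitarymx) -> \sum_x p W x = k%:R.
  move=> uW; apply: (@complexI R); rewrite rmorph_sum rmorph_nat.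
  rewrite -(sum_colnorm2 uP (tensor_unitary uW)).
  by apply: eq_bigr => x _; rewrite pE.
apply: (@weighted_sum_le_level_sets _ _ (p U) (p V) (fun x => tensor_rv a 0 x)
  (fun x => tensor_rv b 0 x) _ _ (total U uU) (total V uV)) => u v.
pose S := [set x | u <= tensor_rv a 0 x].
pose T := [set x | v < tensor_rv b 0 x].
(* Tensor entries grow as indices decrease, so superlevel sets are down-sets. *)
have dS : down_set S.
  move=> x y yx; rewrite !inE => /le_trans; apply.
  exact: tensor_rv_nonincr.
have dT : down_set T.
  move=> x y yx; rewrite !inE => /lt_le_trans; apply.
  exact: tensor_rv_nonincr.
have := le_of_complex_sums (pE U) (pE V) (colnorm2_down_sets uU uV uP dS dT).
rewrite natrD.
congr (_ + _ <= _ + _).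
- by apply: eq_bigl => x; rewrite inE.
- by apply: eq_bigl => x; rewrite inE.
- by congr (_%:R); apply: eq_card => x; rewrite !inE.
Qed.

Definition top_rows k m (kN : (k <= m)%N) (W : 'M[C]_m) : 'M[C]_(k, m) :=
  rowsub (widen_ord kN) W.

Lemma top_rows_unitary k m (kN : (k <= m)%N) (W : 'M[C]_m) :
  W \is unitarymx -> top_rows kN W \is unitarymx.
Proof. by apply: unitary_rowsub => i j /(congr1 val) /= /val_inj. Qed.

(** The unitary factors cancel, leaving the leading [k] by [k] block of the diagonal matrix. *)
Lemma trace_top_rows k m (kN : (k <= m)%N) (W Z : 'M[C]_m) (v : 'rV[R]_m) :
  W \is unitarymx -> Z \is unitarymx ->
  \tr (top_rows kN W *m (W^t* *m real_diag v *m Z) *m (top_rows kN Z)^t*)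
  = (\sum_(i < m | (i < k)%N) v 0 i)%:C.
Proof.
move=> uW uZ.
have -> : top_rows kN W *m (W^t* *m real_diag v *m Z) *m (top_rows kN Z)^t*
    = mxsub (widen_ord kN) (widen_ord kN) (real_diag v).
  rewrite /top_rows (rowsubE _ W) (rowsubE _ Z) adjM !mulmxA.
  rewrite -(mulmxA _ W) (unitarymxP uW) mulmx1 -(mulmxA _ Z) (unitarymxP uZ) mulmx1.
  rewrite -rowsubE; apply/matrixP => i j.
  rewrite !mxE (bigD1 (widen_ord kN j)) //= big1 => [|l lj]; rewrite !mxE ?eqxx.
    by rewrite conjC1 mulr1 addr0.
  by rewrite [widen_ord kN j == l]eq_sym (negPf lj) conjC0 mulr0.
rewrite (big_ord_narrow kN) rmorph_sum /=; apply: eq_bigr => i _.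
by rewrite !mxE eqxx.
Qed.

End TensorMajorization.

(** * The two majorization statements *)

Section Majorization.
Variables (R : realType) (n : nat) (d : 'I_n -> nat).
Local Notation C := R[i].
Local Notation N := #|{: multi_index d}|.
Implicit Types A B U V : forall i : 'I_n, 'M[C]_(d i).

Lemma eq_tensor A B : (forall i, A i = B i) -> tensor A = tensor B.
Proof.
by move=> AB; apply/matrixP => k l; rewrite !mxE; apply: eq_bigr => i _; rewrite AB.
Qed.

Lemma trace_tensor_cross k (P Q : 'M[C]_(k, N)) U V (a : forall i, 'rV[R]_(d i)) :
  (forall i, nonincr_ge0 (a i)) ->
  \tr (P *m tensor (fun i => (U i)^t* *m real_diag (a i) *m V i) *m Q^t*)
  + \tr (Q *m (tensor (fun i => (U i)^t* *m real_diag (a i) *m V i))^t* *m P^t*)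
  <= \tr (P *m tensor (fun i => (U i)^t* *m real_diag (a i) *m U i) *m P^t*)
     + \tr (Q *m tensor (fun i => (V i)^t* *m real_diag (a i) *m V i) *m Q^t*).
Proof.
move=> a0; rewrite !tensor_decomp.
apply: trace_cross_le => x; rewrite mxE ler0c.
exact: tensor_rv_ge0.
Qed.

(** The top left and right singular vectors of the sum, as [P] and [Q], attain its [k] largest
    singular values. The cross bound for each summand leaves two positive semidefinite sums, one in
    the left and one in the right singular bases of the factors, and Ky Fan's inequality applies to
    both. *)
Lemma sigma_tensor_add A B :
  weakly_majorized (sigma (tensor_mx A + tensor_mx B))
    (decreasing (tensor_rv (fun i => sigma (A i))
                 + tensor_rv (fun i => sigma (B i)))).
Proof.
move=> k kN; rewrite decreasingK decreasing_id; last exact: sigma_nonincr.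
rewrite !tensor_mxE.
have /fin_all_exists[U /fin_all_exists[V UVA]] :=
  fun i => singular_value_decomposition (A i).
have /fin_all_exists[U' /fin_all_exists[V' UVB]] :=
  fun i => singular_value_decomposition (B i).
have eA : tensor A = tensor (fun i => (U i)^t* *m real_diag (sigma (A i)) *m V i).
  by apply: eq_tensor => i; case: (UVA i).
have eB : tensor B = tensor (fun i => (U' i)^t* *m real_diag (sigma (B i)) *m V' i).
  by apply: eq_tensor => i; case: (UVB i).
have sA i : nonincr_ge0 (sigma (A i)).
  by split; [exact: sigma_ge0 | exact: sigma_nonincr].
have sB i : nonincr_ge0 (sigma (B i)).
  by split; [exact: sigma_ge0 | exact: sigma_nonincr].
have [uU uV] : (forall i, U i \is unitarymx) /\ (forall i, V i \is unitarymx).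
  by split=> i; case: (UVA i).
have [uU' uV'] : (forall i, U' i \is unitarymx) /\ (forall i, V' i \is unitarymx).
  by split=> i; case: (UVB i).
have [W [Z [uW uZ eX]]] := singular_value_decomposition (tensor A + tensor B).
have kN' : (k <= N)%N by case/andP: kN.
have tP := trace_top_rows kN' (sigma (tensor A + tensor B)) uW uZ.
have tQ := trace_top_rows kN' (sigma (tensor A + tensor B)) uZ uW.
have eX' : (tensor A + tensor B)^t*
    = Z^t* *m real_diag (sigma (tensor A + tensor B)) *m W.
  by rewrite [in LHS]eX !adjM trmxCK adj_real_diag mulmxA.
rewrite -eX in tP; rewrite -eX' in tQ.
have uP := top_rows_unitary kN' uW; have uQ := top_rows_unitary kN' uZ.
have kP := ky_fan_tensor kN uP uU uU' sA sB.
have kQ := ky_fan_tensor kN uQ uV uV' sA sB.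
have cA := trace_tensor_cross (top_rows kN' W) (top_rows kN' Z) U V sA.
have cB := trace_tensor_cross (top_rows kN' W) (top_rows kN' Z) U' V' sB.
rewrite -eA in cA; rewrite -eB in cB.
by rewrite -lecR; apply: (le_trace_of_cross tP tQ cA cB kP kQ).
Qed.

(** Here one orthonormal family of top eigenvectors suffices, and Ky Fan's inequality applies
    directly. *)
Lemma lambda_tensor_add A B : (forall i, psd (A i) /\ psd (B i)) ->
  majorized (lambda (tensor_mx A + tensor_mx B))
    (decreasing (tensor_rv (fun i => lambda (A i))
                 + tensor_rv (fun i => lambda (B i)))).
Proof.
move=> pAB; rewrite !tensor_mxE.
have [hA hB] : (forall i, A i \is hermsymmx) /\ (forall i, B i \is hermsymmx).
  by split=> i; case: (pAB i) => -[hA _] [hB _].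
have /fin_all_exists2[U uU eU] := fun i => lambda_spectral (hA i).
have /fin_all_exists2[V uV eV] := fun i => lambda_spectral (hB i).
have sA i : nonincr_ge0 (lambda (A i)).
  split=> [j|]; last exact: lambda_nonincr.
  by apply: lambda_ge0; case: (pAB i).
have sB i : nonincr_ge0 (lambda (B i)).
  split=> [j|]; last exact: lambda_nonincr.
  by apply: lambda_ge0; case: (pAB i).
have eA := eq_tensor eU; have eB := eq_tensor eV.
have hX : tensor A + tensor B \is hermsymmx.
  apply/hermsymP; rewrite adjD !tensor_adj.
  congr (_ + _); apply: eq_tensor => i; apply/hermsymP; [exact: hA | exact: hB].
have [W uW eX] := lambda_spectral hX.
split=> [k kN|].
  rewrite decreasingK lambda_decreasing.
  have kN' : (k <= N)%N by case/andP: kN.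
  rewrite -lecR -(trace_top_rows kN' _ uW uW) -eX eA eB.
  exact: ky_fan_tensor (top_rows_unitary _ uW) uU uV sA sB.
(* Equality of the full sums: both are the trace of [tensor A + tensor B]. *)
rewrite lambda_decreasing decreasingK [RHS](sum_decreasing _ id).
have tX : \tr (tensor A + tensor B) = (\sum_i lambda (tensor A + tensor B) 0 i)%:C.
  by rewrite -(trace_unitary_diag _ uW) -eX.
apply: (@complexI R); rewrite -tX mxtraceD eA eB !trace_tensor // -rmorphD.
by rewrite -big_split; congr (_%:C); apply: eq_bigr => x _; rewrite [RHS]mxE.
Qed.

End Majorization.

Theorem corollary2 (R : realType) (n : nat) (hn : (0 < n)%N)
    (d : 'I_n -> nat) (hd : forall i : 'I_n, (0 < d i)%N)
    (A B : forall i : 'I_n, 'M[R[i]]_(d i)) :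
  weakly_majorized
    (sigma (tensor_mx A + tensor_mx B))
    (decreasing (tensor_rv (fun i => sigma (A i))
                 + tensor_rv (fun i => sigma (B i))))
  /\ ((forall i : 'I_n, psd (A i) /\ psd (B i)) ->
      majorized
        (lambda (tensor_mx A + tensor_mx B))
        (decreasing (tensor_rv (fun i => lambda (A i))
                     + tensor_rv (fun i => lambda (B i))))).
Proof.
by split; [exact: sigma_tensor_add | exact: lambda_tensor_add].
Qed.
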